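(* Let a graph $(V,E)$ be given with $V=\{v_1,\ldots,v_{|V|}\}$, and let $I\subseteq V$ and $P\subseteq V$ be given. Let $0$ denote an additional node not in $V$. Consider the following two conditions: (a) there exists $g:I\to E$ such that $i\in g(i)$ for all $i\in I$ and the graph $(V\cup\{0\},\,g(I)\cup E_{P0})$ is connected, where $E_{P0}=\{\{i,0\}\mid i\in P\}$; (b) there exists $h:I\to V$ satisfying two requirements: (i) for every $i\in I$, $h(i)=i$ or $\{i,h(i)\}\in E$; and (ii) $P\cup h(I)=V$. Then, if (a) holds then (b) holds. Conversely, if $(V,E)$ is connected, $P\neq\emptyset$ and (b) holds, then (a) holds.
   Context: Graphs are finite and undirected; an edge is an unordered pair $\{i,j\}$ of its two end nodes. For a function $g$ on $I$, $g(I):=\{g(i)\mid i\in I\}$, and similarly for $h(I)$.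
   Formalization: The converse additionally assumes that V has at least two nodes whenever I is nonempty: if V = I = P = {v}, then E is empty, (b) holds with h(v) = v, but no map g from I to E exists, so (a) fails. *)

(* Defs.v *)
From mathcomp Require Import all_boot.

Set Implicit Arguments.
Unset Strict Implicit.
Unset Printing Implicit Defensive.

(* A finite simple graph is given by a finType V of nodes and a set E of
   2-element subsets of V. *)
Definition graph_edges (V : finType) (E : {set {set V}}) : Prop :=
  forall e, e \in E -> #|e| = 2.

Definition adjacent (V : finType) (E : {set {set V}}) : rel V :=
  fun x y => [set x; y] \in E.

Definition connected_graph (V : finType) (E : {set {set V}}) : Prop :=
  forall x y : V, connect (adjacent E) x y.

(* V together with the additional node 0 is [option V], with None as 0; an
   edge of (V, E) becomes an edge of the larger graph by taking its image
   under Some. *)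
Definition lift_edges (V : finType) (F : {set {set V}}) : {set {set option V}} :=
  [set Some @: e | e : {set V} in F].

Definition root_edges (V : finType) (P : {set V}) : {set {set option V}} :=
  [set [set Some i; None] | i in P].

(* A map I -> E (resp. I -> V) is given by a function on all of V whose values
   outside I are irrelevant: only the image of I is used. *)
Definition conditionA (V : finType) (E : {set {set V}}) (I P : {set V}) : Prop :=
  exists g : V -> {set V},
    [/\ forall i, i \in I -> g i \in E,
        forall i, i \in I -> i \in g i
      & connected_graph (lift_edges (g @: I) :|: root_edges P)].

Definition conditionB (V : finType) (E : {set {set V}}) (I P : {set V}) : Prop :=
  exists h : V -> V,
    (forall i, i \in I -> h i = i \/ [set i; h i] \in E) /\
    P :|: h @: I = [set: V].

(* Main.v *)
Require Import Defs.
From mathcomp Require Import all_boot.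

Set Implicit Arguments.
Unset Strict Implicit.
Unset Printing Implicit Defensive.

(** Both implications orient edges along a distance function
    ([descent_to_set]).

    From (a) to (b): measure the distance to the additional node in the
    connected graph, and let [h i] be the end of [g i] that lies farther away.
    A node [v] outside [P] has a neighbour closer to the additional node; the
    edge joining them is not one of the edges at the additional node that come
    from [P], so it is some [g i], and then [h i = v].

    From (b) to (a): choose for every [v] outside [P] an [i = k v] in [I] with
    [h i = v].  The map [k] is injective outside [P].  Let [R] be the set of
    nodes from which iterating [k] leads into [P].  Inside [R] the edges
    [{v, k v}], which are available as values [g (k v)], already connect
    everything to the additional node.  The complement of [R] is stable under
    [k], and [k] is injective on it, so [k] permutes it
    ([stable_injective_subset_image]): it lies in the image of [k], hence
    in [I], and none of its nodes is a value of [k] at a node of [R] outside [P].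
    Each of these nodes is thus free to choose as [g v] the first edge of a shortest
    path in [(V, E)] towards [R]. *)

(** Distance to [S], together with a choice of the first step of a shortest
    path; a step is promised only where [S] can be reached. *)
Lemma descent_to_set (T : finType) (e : rel T) (S : {set T}) :
  exists (f : T -> T) (d : T -> nat), forall x, x \notin S ->
    (exists2 s, s \in S & connect e x s) -> e x (f x) /\ d (f x) < d x.
Proof.
pose reach x n := [exists p : n.-tuple T, path e x p && (last x p \in S)].
have reachP x p : path e x p -> last x p \in S -> reach x (size p).
  by move=> ep Sp; apply/existsP; exists (in_tuple p); rewrite ep Sp.
have [d dP] : exists d : T -> nat, forall x n, reach x n ->
    reach x (d x) /\ d x <= n.
  apply: (@fin_all_exists T (fun=> nat)
    (fun x m => forall n, reach x n -> reach x m /\ m <= n)) => x.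
  have [[n xn]|none] : (exists n, reach x n) \/ ~ (exists n, reach x n).
  - have [/'exists_andP[s [Ss /connectP[p ep def_s]]]|no] :=
      boolP [exists s, (s \in S) && connect e x s].
      by left; exists (size p); apply: reachP; rewrite -?def_s.
    right=> -[n /'exists_andP[p [ep Sp]]]; case/negP: no.
    by apply/'exists_andP; exists (last x p); split=> //; apply/connectP; exists p.
  - have ex : exists n, reach x n by exists n.
    by case: (ex_minnP ex) => m xm min; exists m => j /min.
  - by exists 0 => j xj; case: none; exists j.
have [f fP] : exists f : T -> T, forall x, x \notin S ->
    (exists2 s, s \in S & connect e x s) -> e x (f x) /\ d (f x) < d x.
  apply: (@fin_all_exists T (fun=> T) (fun x y => x \notin S ->
    (exists2 s, s \in S & connect e x s) -> e x y /\ d y < d x)) => x.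
  have [/'exists_andP[y exy]|no] := boolP [exists y, e x y && (d y < d x)].
    by exists y.
  exists x => xS [s Ss /connectP[p ep def_s]]; case/negP: no.
  have xp : reach x (size p) by apply: reachP; rewrite -?def_s.
  have [/'exists_andP[[q q_size] /= [eq Sq]] _] := dP _ _ xp.
  case: q q_size eq Sq => [|y q] /=; first by rewrite (negPf xS).
  move=> /eqP q_size /andP[exy eq] Sq.
  apply/'exists_andP; exists y; split=> //; rewrite -q_size ltnS.
  by have [] := dP y (size q) (reachP _ _ eq Sq).
by exists f, d.
Qed.

Lemma stable_injective_subset_image (T : finType) (k : T -> T) (Q : {set T}) :
  {in Q, forall x, k x \in Q} -> {in Q &, injective k} -> Q \subset k @: Q.
Proof.
move=> kQ k_inj; have sub : k @: Q \subset Q.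
  by apply/subsetP=> _ /imsetP[x Qx ->]; apply: kQ.
by have /eqP-> : k @: Q == Q by rewrite eqEcard sub card_in_imset /=.
Qed.

Lemma adjacent_sym (V : finType) (E : {set {set V}}) : symmetric (adjacent E).
Proof. by move=> x y; rewrite /adjacent setUC. Qed.

Lemma connected_graph_from_root (V : finType) (E : {set {set V}}) (r : V) :
  (forall x, connect (adjacent E) x r) -> connected_graph E.
Proof.
move=> to_r x y; apply: connect_trans (to_r x) _.
by rewrite (sym_connect_sym (@adjacent_sym V E)).
Qed.

Lemma connected_graph_neighbour (V : finType) (E : {set {set V}}) (x : V) :
  connected_graph E -> 1 < #|V| -> exists y, adjacent E x y.
Proof.
move=> connE /card_gt1P[a [b [_ _ neq_ab]]].
have [y neq_xy] : exists y, x != y.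
  by have [eq_xa|] := eqVneq x a; [exists b; rewrite eq_xa | exists a].
have /connectP[[|z p] /= ep def_y] := connE x y.
  by rewrite def_y eqxx in neq_xy.
by exists z; case/andP: ep.
Qed.

Lemma card2_setE (T : finType) (A : {set T}) (x y : T) :
  #|A| = 2 -> x \in A -> y \in A -> x != y -> A = [set x; y].
Proof.
move=> A2 Ax Ay neq_xy; apply/esym/eqP.
by rewrite eqEcard subUset !sub1set Ax Ay cards2 neq_xy A2.
Qed.

Lemma adjacent_lift_edges (V : finType) (F : {set {set V}})
    (P : {set V}) (x y : V) :
  [set x; y] \in F ->
  adjacent (lift_edges F :|: root_edges P) (Some x) (Some y).
Proof.
move=> Fxy; rewrite /adjacent inE; apply/orP; left.
by apply/imsetP; exists [set x; y]; rewrite // imsetU1 imset_set1.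
Qed.

Lemma adjacent_root_edges (V : finType) (F : {set {set V}})
    (P : {set V}) (x : V) :
  x \in P -> adjacent (lift_edges F :|: root_edges P) (Some x) None.
Proof.
by move=> Px; rewrite /adjacent inE; apply/orP; right; apply/imsetP; exists x.
Qed.

Lemma adjacent_not_root (V : finType) (F : {set {set V}})
    (P : {set V}) (x : V) (y : option V) :
  x \notin P -> adjacent (lift_edges F :|: root_edges P) (Some x) y ->
  exists A w, [/\ A \in F, x \in A, w \in A & y = Some w].
Proof.
move=> notPx; rewrite /adjacent inE => /orP[|] /imsetP[A FA eqA].
  have : Some x \in Some @: A by rewrite -eqA set21.
  rewrite mem_imset; last exact: Some_inj.
  have /imsetP[w Aw ->] : y \in Some @: A by rewrite -eqA set22.
  by exists A, w.
have : Some x \in [set Some A; None] by rewrite -eqA set21.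
by rewrite !inE orbF => /eqP[eq_xA]; rewrite eq_xA FA in notPx.
Qed.

Lemma conditionA_conditionB (V : finType) (E : {set {set V}}) (I P : {set V}) :
  graph_edges E -> conditionA E I P -> conditionB E I P.
Proof.
move=> E2 [g [gE gI conn]].
have [f [d fdP]] := descent_to_set
  (adjacent (lift_edges (g @: I) :|: root_edges P)) [set None].
(* [h i] is the end of [g i] farther from the additional node. *)
pose h i := [arg max_(x > i in g i) d (Some x)].
have hP i : i \in I ->
    h i \in g i /\ forall y, y \in g i -> d (Some y) <= d (Some (h i)).
  by move=> Ii; rewrite /h; case: arg_maxnP => [|x gx xmax]; first exact: gI.
exists h; split=> [i Ii|].
  have [hi_gi _] := hP i Ii.
  have [->|neq] := eqVneq (h i) i; [by left | right].
  rewrite -(card2_setE (E2 _ (gE i Ii)) (gI i Ii) hi_gi) ?gE //.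
  by rewrite eq_sym.
apply/setP=> v; rewrite !inE; have [//|notPv /=] := boolP (v \in P).
have [adj lt_d] : adjacent (lift_edges (g @: I) :|: root_edges P)
    (Some v) (f (Some v)) /\ d (f (Some v)) < d (Some v).
  by apply: fdP; [rewrite inE | exists None; [rewrite inE | apply: conn]].
have [_ [w [/imsetP[i Ii ->] gv gw eq_w]]] := adjacent_not_root notPv adj.
rewrite eq_w in lt_d; apply/imsetP; exists i => //.
have neq_vw : v != w by apply: contraTneq lt_d => ->; rewrite ltnn.
have [h_gi max_h] := hP i Ii.
move: h_gi; rewrite (card2_setE (E2 _ (gE i Ii)) gv gw neq_vw) !inE.
case/orP=> /eqP // eq_hw; have := max_h v gv.
by rewrite eq_hw leqNgt lt_d.
Qed.

Lemma conditionB_conditionA (V : finType) (E : {set {set V}}) (I P : {set V}) :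
  connected_graph E -> P != set0 -> (I != set0 -> 1 < #|V|) ->
  conditionB E I P -> conditionA E I P.
Proof.
move=> connE /set0Pn[p0 Pp0] V_gt1 [h [hE cover]].
have [k kP] : exists k : V -> V, forall v, v \notin P ->
    k v \in I /\ h (k v) = v.
  apply: (@fin_all_exists V (fun=> V) (fun v i => v \notin P ->
    i \in I /\ h i = v)) => v.
  have : v \in P :|: h @: I by rewrite cover inE.
  by case/setUP=> [Pv|/imsetP[i Ii ->]]; [exists v; rewrite Pv | exists i].
pose R := [set v | [exists p in P, fconnect k v p]].
have PR v : v \in P -> v \in R.
  by move=> Pv; rewrite inE; apply/exists_inP; exists v.
have kR v : k v \in R -> v \in R.
  rewrite !inE => /exists_inP[p Pp kvp]; apply/exists_inP; exists p => //.
  exact: connect_trans (fconnect1 k v) kvp.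
(* Outside [R] the map [k] is a permutation, so every node there is a value of [k]. *)
have notR_I v : v \notin R -> v \in I.
  rewrite -in_setC => notRv.
  have notR_P w : w \in ~: R -> w \notin P.
    by rewrite inE; apply: contra; apply: PR.
  have sub : ~: R \subset k @: ~: R.
    apply: stable_injective_subset_image => [x|x y Rx Ry eq_k].
      by rewrite !in_setC; apply: contra; apply: kR.
    have [_ <-] := kP x (notR_P _ Rx).
    by have [_ <-] := kP y (notR_P _ Ry); rewrite eq_k.
  by have /imsetP[w /notR_P/kP[Ikw _] ->] := subsetP sub v notRv.
have [f [d fdP]] := descent_to_set (adjacent E) R.
have step v : v \notin R -> adjacent E v (f v) /\ d (f v) < d v.
  by move=> notRv; apply: fdP => //; exists p0; [apply: PR | apply: connE].
(* [q i] is the other end of the edge [g i]. *)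
have [q qP] : exists q : V -> V, forall i, i \in I ->
    [/\ adjacent E i (q i), i \notin R -> q i = f i
      & i \in R -> h i != i -> q i = h i].
  apply: (@fin_all_exists V (fun=> V) (fun i y => i \in I ->
    [/\ adjacent E i y, i \notin R -> y = f i
      & i \in R -> h i != i -> y = h i])) => i.
  have [Ii|] := boolP (i \in I); last by exists i.
  have [Ri|notRi] := boolP (i \in R); last first.
    by exists (f i) => _; split=> //; have [] := step i notRi.
  have [eq_hi|neq_hi] := eqVneq (h i) i; last first.
    exists (h i) => _; split=> //; case: (hE i Ii) => // eq_hi.
    by rewrite eq_hi eqxx in neq_hi.
  have [y adj_iy] : exists y, adjacent E i y.
    by apply: connected_graph_neighbour connE (V_gt1 _); apply/set0Pn; exists i.
  by exists y.
pose g i := [set i; q i].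
exists g; split=> [i /qP[]//|i _|]; first exact: set21.
have adjI i : i \in I ->
    adjacent (lift_edges (g @: I) :|: root_edges P) (Some i) (Some (q i)).
  by move=> Ii; apply: adjacent_lift_edges; apply: imset_f.
have connP v : v \in P ->
    connect (adjacent (lift_edges (g @: I) :|: root_edges P)) (Some v) None.
  by move=> Pv; apply/connect1/adjacent_root_edges.
have connR v : v \in R ->
    connect (adjacent (lift_edges (g @: I) :|: root_edges P)) (Some v) None.
  rewrite inE => /exists_inP[p Pp /iter_findex].
  move: (findex k v p) => n; elim: n v => [|n IHn] v /= eq_p.
    by rewrite connP ?eq_p.
  have [/connP//|notPv] := boolP (v \in P).
  have [Ikv hkv] := kP v notPv.
  have kvp : iter n k (k v) = p by rewrite -iterSr.
  (* A fixed point of [k] outside [P] would never reach [P]. *)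
  have neq_kv : k v != v.
    apply: contraNneq notPv => eq_kv.
    by rewrite -(_ : p = v) // -eq_p -iterS iter_fix.
  have Rkv : k v \in R.
    by rewrite inE; apply/exists_inP; exists p; rewrite // -kvp fconnect_iter.
  have [_ _ qkv] := qP _ Ikv; apply: connect_trans (IHn _ kvp).
  apply: connect1; rewrite adjacent_sym -{2}hkv -qkv ?adjI //.
  by rewrite hkv eq_sym.
apply: (@connected_graph_from_root _ _ None) => -[v|]; last exact: connect0.
have [n] := ubnP (d v); elim: n v => // n IHn v; rewrite ltnS => le_dv.
have [/connR//|notRv] := boolP (v \in R).
have Iv := notR_I v notRv; have [_ qv _] := qP v Iv.
have [_ lt_d] := step v notRv.
apply: connect_trans (connect1 (adjI v Iv)) _; rewrite qv //.
exact/IHn/(leq_trans lt_d).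
Qed.

(* The proviso [I != set0 -> 1 < #|V|] in the converse excludes only the case
   of a single node v with I = {v}: then E is empty, so there is no map
   I -> E at all and (a) fails, although (b) holds for P = {v}. *)
Theorem mainTheorem2 (V : finType) (E : {set {set V}}) (I P : {set V}) :
  graph_edges E ->
  (conditionA E I P -> conditionB E I P) /\
  (connected_graph E -> P != set0 -> (I != set0 -> 1 < #|V|) ->
   conditionB E I P -> conditionA E I P).
Proof.
move=> E2; split; first exact: conditionA_conditionB.
exact: conditionB_conditionA.
Qed.
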